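(* Let $\mathbb{M}_1=(\mathbb{F}_1,V_1)$ and $\mathbb{M}_2=(\mathbb{F}_2,V_2)$ be polarity-based models with $\mathbb{F}_i=(G_i,M_i,I_i,{R_\Box}_i,{R_\Diamond}_i)$ for $i=1,2$, and let $(S,T)$ be a simulation from $\mathbb{M}_1$ to $\mathbb{M}_2$. Then for every formula $\varphi$ of the non-distributive modal $\mu$-calculus: (1) for all $g_1\in G_1,g_2\in G_2$, if $g_1Sg_2$ and $\mathbb{M}_1,g_1\Vdash\varphi$ then $\mathbb{M}_2,g_2\Vdash\varphi$; (2) for all $m_1\in M_1,m_2\in M_2$, if $m_1Tm_2$ and $\mathbb{M}_2,m_2\succ\varphi$ then $\mathbb{M}_1,m_1\succ\varphi$.
   Context: Polarity-based model: $\mathbb{M}=(\mathbb{F},V)$ where $\mathbb{F}=(G,M,I,R_\Box,R_\Diamond)$, $I\subseteq G\times M$, $R_\Box\subseteq G\times M$, $R_\Diamond\subseteq M\times G$ are $I$-compatible (the sets $R_\Box^{(0)}[m],R_\Box^{(1)}[g],R_\Diamond^{(0)}[g],R_\Diamond^{(1)}[m]$ are Galois-stable, where $T^{(1)}[U']=\{w\mid\forall u\in U'\,uTw\}$, $T^{(0)}[W']=\{u\mid\forall w\in W'\,uTw\}$, $B^\uparrow=I^{(1)}[B]$, $Y^\downarrow=I^{(0)}[Y]$, and Galois-stable means closed under $(\cdot)^{\uparrow\downarrow}$ resp. $(\cdot)^{\downarrow\uparrow}$), and $V$ maps atoms $p\in\mathrm{P}$ to formal concepts $c=([\![c]\!],(\![c]\!))$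 (pairs with $[\![c]\!]=(\![c]\!)^\downarrow$, $(\![c]\!)=[\![c]\!]^\uparrow$), which form a complete lattice $\mathbb{P}^+$ under inclusion of extensions. Formulas of the non-distributive modal $\mu$-calculus: $\varphi::=p\mid x\mid y\mid\bot\mid\top\mid\varphi\vee\varphi\mid\varphi\wedge\varphi\mid\Box\varphi\mid\Diamond\varphi\mid\mu y.\varphi\mid\nu x.\varphi$ (formulas evaluated at points of a model have all variables bound). Their value in $\mathbb{P}^+$: $\top,\bot,\wedge,\vee$ are top, bottom, meet, join; $\Box c=(R_\Box^{(0)}[(\![c]\!)],I^{(1)}[R_\Box^{(0)}[(\![c]\!)]])$; $\Diamond c=(I^{(0)}[R_\Diamond^{(0)}[[\![c]\!]]],R_\Diamond^{(0)}[[\![c]\!]])$; $\mu y.\varphi$ and $\nu x.\varphi$ are the least and greatest fixed points of the monotone map $c\mapsto$ (value of $\varphi$ with the bound variable assigned $c$). $\mathbb{M},g\Vdash\varphi$ iff $g$ is in the extension of the value of $\varphi$, and $\mathbb{M},m\succ\varphi$ iff $m$ is in its intension. Simulation from $\mathbb{M}_1$ to $\mathbb{M}_2$: a pair $(S,T)$ with $S\subseteq G_1\times G_2$, $T\subseteq M_1\times M_2$ such that for all atoms $p$, $g_i\in G_i$, $m_i\in M_i$ (with $R^c$ denoting the complement of a relation $R$): 1. if $g_1Sg_2$ and $g_1\in[\![V_1(p)]\!]$ then $g_2\in[\![V_2(p)]\!]$; 2. if $m_1Tm_2$ and $m_2\in(\![V_2(p)]\!)$ then $m_1\in(\![V_1(p)]\!)$;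 3. if $g_1Sg_2$ and $g_2I_2^cm_2$, there is $m_1\in M_1$ with $g_1I_1^cm_1$ and $m_1Tm_2$; 4. if $m_1Tm_2$ and $g_1I_1^cm_1$, there is $g_2\in G_2$ with $g_2I_2^cm_2$ and $g_1Sg_2$; 5. if $g_1Sg_2$ and $g_2{R_\Box}_2^cm_2$, there is $m_1\in M_1$ with $g_1{R_\Box}_1^cm_1$ and $m_1Tm_2$; 6. if $m_1Tm_2$ and $m_1{R_\Diamond}_1^cg_1$, there is $g_2\in G_2$ with $m_2{R_\Diamond}_2^cg_2$ and $g_1Sg_2$. *)

(* Defs.v *)
From HB Require Import structures.
From mathcomp Require Import all_boot all_order.
From mathcomp Require Import boolp classical_sets.

Set Implicit Arguments.
Unset Strict Implicit.
Unset Printing Implicit Defensive.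

Import Order.Theory.
Local Open Scope classical_set_scope.

(* T^(1)[U] and T^(0)[W]; for a single element, T^(0)[w] is T^(0)[{w}]. *)
Definition rel1 (A B : Type) (T : A -> B -> Prop) (U : set A) : set B :=
  [set w | forall u, U u -> T u w].
Definition rel0 (A B : Type) (T : A -> B -> Prop) (W : set B) : set A :=
  [set u | forall w, W w -> T u w].

Definition up (G M : Type) (I : G -> M -> Prop) (B : set G) : set M := rel1 I B.
Definition down (G M : Type) (I : G -> M -> Prop) (Y : set M) : set G := rel0 I Y.

Definition stable_obj (G M : Type) (I : G -> M -> Prop) (B : set G) : Prop :=
  down I (up I B) = B.
Definition stable_feat (G M : Type) (I : G -> M -> Prop) (Y : set M) : Prop :=
  up I (down I Y) = Y.

Record frame := Frame {
  obj : Type;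
  feat : Type;
  inc : obj -> feat -> Prop;
  rbox : obj -> feat -> Prop;
  rdia : feat -> obj -> Prop;
  rbox0_stable : forall m, stable_obj inc (rel0 rbox [set m]);
  rbox1_stable : forall g, stable_feat inc (rel1 rbox [set g]);
  rdia0_stable : forall g, stable_feat inc (rel0 rdia [set g]);
  rdia1_stable : forall m, stable_obj inc (rel1 rdia [set m])
}.

Section Galois.
Variables (G M : Type) (I : G -> M -> Prop).

Lemma sub_downup (B : set G) : B `<=` down I (up I B).
Proof. by move=> g Bg m /(_ g Bg). Qed.

Lemma sub_updown (Y : set M) : Y `<=` up I (down I Y).
Proof. by move=> m Ym g /(_ m Ym). Qed.

Lemma up_anti (B B' : set G) : B `<=` B' -> up I B' `<=` up I B.
Proof. by move=> BB' m h g /BB'; apply: h. Qed.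

Lemma down_anti (Y Y' : set M) : Y `<=` Y' -> down I Y' `<=` down I Y.
Proof. by move=> YY' g h m /YY'; apply: h. Qed.

Lemma updownup (B : set G) : up I (down I (up I B)) = up I B.
Proof.
by apply/seteqP; split; [exact/up_anti/sub_downup|exact: sub_updown].
Qed.

Lemma downupdown (Y : set M) : down I (up I (down I Y)) = down I Y.
Proof.
by apply/seteqP; split; [exact/down_anti/sub_updown|exact: sub_downup].
Qed.

Lemma rel0_stable_obj (T : G -> M -> Prop) (W : set M) :
  (forall m, stable_obj I (rel0 T [set m])) -> stable_obj I (rel0 T W).
Proof.
move=> sT; apply/seteqP; split=> [g hg m Wm|]; last exact: sub_downup.
have : rel0 T [set m] g; last by apply.
rewrite -(sT m); apply: down_anti g hg; apply: up_anti => g hg m' ->.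
exact: hg.
Qed.

Lemma rel0_stable_feat (T : M -> G -> Prop) (W : set G) :
  (forall g, stable_feat I (rel0 T [set g])) -> stable_feat I (rel0 T W).
Proof.
move=> sT; apply/seteqP; split=> [m hm g Wg|]; last exact: sub_updown.
have : rel0 T [set g] m; last by apply.
rewrite -(sT g); apply: up_anti m hm; apply: down_anti => m hm g' ->.
exact: hm.
Qed.

End Galois.

Record concept (F : frame) := Concept {
  extent : set (obj F);
  intent : set (feat F);
  extentE : extent = down (inc (f := F)) intent;
  intentE : intent = up (inc (f := F)) extent
}.

Lemma concept_eq (F : frame) (c d : concept F) : extent c = extent d -> c = d.
Proof.
case: c d => [A X eA eX] [B Y eB eY] /= AB.
have XY : X = Y by rewrite eX eY AB.
case: _ / AB eB eY XY => eB eY XY; case: _ / XY eB eY => eB eY.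
by rewrite (Prop_irrelevance eA eB) (Prop_irrelevance eX eY).
Qed.

Definition concept_of_obj (F : frame) (B : set (obj F))
    (sB : stable_obj (inc (f := F)) B) : concept F :=
  Concept (esym sB) erefl.

Definition concept_of_feat (F : frame) (Y : set (feat F))
    (sY : stable_feat (inc (f := F)) Y) : concept F :=
  Concept erefl (esym sY).

Section ConceptLattice.
Variable F : frame.
Implicit Types c d : concept F.
Let I := inc (f := F).

Lemma conceptI_subproof c d : stable_obj I (extent c `&` extent d).
Proof.
apply/seteqP; split; last exact: sub_downup.
move=> g hg; rewrite (extentE c) (extentE d); split; apply: down_anti hg.
- by rewrite {1}(intentE c); apply: up_anti => h [].
- by rewrite {1}(intentE d); apply: up_anti => h [].
Qed.

Lemma conceptU_subproof c d : stable_feat I (intent c `&` intent d).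
Proof.
apply/seteqP; split; last exact: sub_updown.
move=> m hm; rewrite (intentE c) (intentE d); split; apply: up_anti hm.
- by rewrite {1}(extentE c); apply: down_anti => h [].
- by rewrite {1}(extentE d); apply: down_anti => h [].
Qed.

Lemma concept1_subproof : stable_obj I setT.
Proof. by apply/seteqP; split=> // g _; apply: sub_downup. Qed.

Lemma concept0_subproof : stable_feat I setT.
Proof. by apply/seteqP; split=> // m _; apply: sub_updown. Qed.

Definition cmeet c d := concept_of_obj (conceptI_subproof c d).
Definition cjoin c d := concept_of_feat (conceptU_subproof c d).
Definition ctop := concept_of_obj concept1_subproof.
Definition cbot := concept_of_feat concept0_subproof.

Definition cle c d : bool := `[< extent c `<=` extent d >].

Lemma cle_intent c d : cle c d <-> intent d `<=` intent c.
Proof.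
split=> [/asboolP cd|dc].
- by rewrite (intentE c) (intentE d); apply: up_anti.
- by apply/asboolP; rewrite (extentE c) (extentE d); apply: down_anti.
Qed.

Lemma cle_refl : reflexive cle. Proof. by move=> c; apply/asboolP. Qed.

Lemma cle_anti : antisymmetric cle.
Proof.
by move=> c d /andP[/asboolP cd /asboolP dc]; apply/concept_eq/seteqP.
Qed.

Lemma cle_trans : transitive cle.
Proof.
by move=> d c e /asboolP cd /asboolP de; apply/asboolP/(subset_trans cd de).
Qed.

Fact concept_display : Order.disp_t. Proof. exact: Order.Disp tt tt. Qed.

HB.instance Definition _ := gen_eqMixin (concept F).
HB.instance Definition _ := gen_choiceMixin (concept F).
HB.instance Definition _ :=
  Order.Le_isPOrder.Build concept_display (concept F)
    cle_refl cle_anti cle_trans.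

Lemma cle_meet c d e : (c <= cmeet d e)%O = (c <= d)%O && (c <= e)%O.
Proof.
apply/idP/andP => [/asboolP h|[/asboolP h1 /asboolP h2]].
  by split; apply/asboolP => g /h [].
by apply/asboolP => g cg; split; [apply: h1|apply: h2].
Qed.

Lemma cjoin_le c d e : (cjoin c d <= e)%O = (c <= e)%O && (d <= e)%O.
Proof.
apply/idP/andP => [/cle_intent h|[/cle_intent h1 /cle_intent h2]].
  by split; apply/cle_intent => m /h [].
by apply/cle_intent => m em; split; [apply: h1|apply: h2].
Qed.

Lemma cle_top c : (c <= ctop)%O. Proof. exact/asboolP. Qed.
Lemma cbot_le c : (cbot <= c)%O. Proof. exact/cle_intent. Qed.

HB.instance Definition _ :=
  Order.POrder_isMeetSemilattice.Build concept_display (concept F) cle_meet.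
HB.instance Definition _ :=
  Order.POrder_isJoinSemilattice.Build concept_display (concept F) cjoin_le.
HB.instance Definition _ :=
  Order.hasBottom.Build concept_display (concept F) cbot_le.
HB.instance Definition _ :=
  Order.hasTop.Build concept_display (concept F) cle_top.

End ConceptLattice.

Section CompleteLattice.
Variable F : frame.
Let I := inc (f := F).

Lemma conceptInf_subproof (D : set (concept F)) :
  stable_obj I (\bigcap_(c in D) extent c).
Proof.
apply/seteqP; split; last exact: sub_downup.
move=> g hg c Dc; rewrite (extentE c); apply: down_anti hg.
by rewrite {1}(intentE c); apply: up_anti => h; apply.
Qed.

Definition cinf (D : set (concept F)) : concept F :=
  concept_of_obj (conceptInf_subproof D).

Lemma cinf_glb (D : set (concept F)) (c : concept F) :
  (c <= cinf D)%O <-> forall d, D d -> (c <= d)%O.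
Proof.
split=> [/asboolP h d Dd|h]; first by apply/asboolP => g /h; apply.
by apply/asboolP => g cg d /h /asboolP; apply.
Qed.

Lemma conceptSup_subproof (D : set (concept F)) :
  stable_feat I (\bigcap_(c in D) intent c).
Proof.
apply/seteqP; split; last exact: sub_updown.
move=> m hm c Dc; rewrite (intentE c); apply: up_anti hm.
by rewrite {1}(extentE c); apply: down_anti => h; apply.
Qed.

Definition csup (D : set (concept F)) : concept F :=
  concept_of_feat (conceptSup_subproof D).

Lemma csup_lub (D : set (concept F)) (c : concept F) :
  (csup D <= c)%O <-> forall d, D d -> (d <= c)%O.
Proof.
split=> [/cle_intent h d Dd|h]; first by apply/cle_intent => g /h; apply.
by apply/cle_intent => g cg d /h /cle_intent; apply.
Qed.

End CompleteLattice.

Section Fixpoints.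
Variable F : frame.
Implicit Types (f : concept F -> concept F) (c d : concept F).

Definition is_lfp f c : Prop := f c = c /\ forall d, f d = d -> (c <= d)%O.
Definition is_gfp f c : Prop := f c = c /\ forall d, f d = d -> (d <= c)%O.

(* Definite descriptions: the least (greatest) fixed point when there is one,
   which is the case whenever f is monotone; otherwise a junk value. *)
Definition lfp f : concept F := xget \bot%O [set c | is_lfp f c].
Definition gfp f : concept F := xget \top%O [set c | is_gfp f c].

Lemma is_lfp_inj f c d : is_lfp f c -> is_lfp f d -> c = d.
Proof.
by move=> [fc lc] [fd ld]; apply/le_anti; rewrite (lc _ fd) (ld _ fc).
Qed.

Lemma is_gfp_inj f c d : is_gfp f c -> is_gfp f d -> c = d.
Proof.
by move=> [fc lc] [fd ld]; apply/le_anti; rewrite (lc _ fd) (ld _ fc).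
Qed.

Lemma lfp_cinf f : {homo f : c d / (c <= d)%O} ->
  is_lfp f (cinf [set c | (f c <= c)%O]).
Proof.
move=> fm; set D := [set c | _]; set a := cinf D.
have la d : D d -> (a <= d)%O by have [+ _] := cinf_glb D a; apply.
have Da : D a.
  by apply/cinf_glb => d Dd; exact: le_trans (fm _ _ (la _ Dd)) Dd.
split=> [|d fd]; last by apply: la; rewrite /D /= fd.
by apply/le_anti; rewrite (la (f a)) ?andbT //; apply: fm.
Qed.

Lemma gfp_csup f : {homo f : c d / (c <= d)%O} ->
  is_gfp f (csup [set c | (c <= f c)%O]).
Proof.
move=> fm; set D := [set c | _]; set a := csup D.
have la d : D d -> (d <= a)%O by have [+ _] := csup_lub D a; apply.
have Da : D a.
  by apply/csup_lub => d Dd; exact: le_trans Dd (fm _ _ (la _ Dd)).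
split=> [|d fd]; last by apply: la; rewrite /D /= fd.
by apply/le_anti; rewrite (la (f a)) //=; apply: fm.
Qed.

Lemma lfpE f : {homo f : c d / (c <= d)%O} ->
  lfp f = cinf [set c | (f c <= c)%O].
Proof.
move=> fm; apply: xget_unique; first exact: lfp_cinf.
by move=> d hd; apply: is_lfp_inj hd (lfp_cinf fm).
Qed.

Lemma gfpE f : {homo f : c d / (c <= d)%O} ->
  gfp f = csup [set c | (c <= f c)%O].
Proof.
move=> fm; apply: xget_unique; first exact: gfp_csup.
by move=> d hd; apply: is_gfp_inj hd (gfp_csup fm).
Qed.

End Fixpoints.

Definition cbox (F : frame) (c : concept F) : concept F :=
  concept_of_obj
    (rel0_stable_obj (intent c) (@rbox0_stable F)).

Definition cdia (F : frame) (c : concept F) : concept F :=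
  concept_of_feat
    (rel0_stable_feat (extent c) (@rdia0_stable F)).

(* P: atoms; X: variables bound by nu; Y: variables bound by mu. *)
Inductive form (P : Type) (X Y : eqType) : Type :=
| Atom of P
| NuVar of X
| MuVar of Y
| Bot
| Top
| Or of form P X Y & form P X Y
| And of form P X Y & form P X Y
| Box of form P X Y
| Dia of form P X Y
| Mu of Y & form P X Y
| Nu of X & form P X Y.

Arguments Bot {P X Y}.
Arguments Top {P X Y}.

Fixpoint occurs_free (P : Type) (X Y : eqType) (v : X + Y)
    (phi : form P X Y) : bool :=
  match phi with
  | NuVar x => v == inl x
  | MuVar y => v == inr y
  | Or a b | And a b => occurs_free v a || occurs_free v b
  | Box a | Dia a => occurs_free v a
  | Mu y a => (v != inr y) && occurs_free v a
  | Nu x a => (v != inl x) && occurs_free v a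
  | Atom _ | Bot | Top => false
  end.

Definition closed_form (P : Type) (X Y : eqType) (phi : form P X Y) : Prop :=
  forall v, ~~ occurs_free v phi.

Record model (P : Type) := Model {
  mframe :> frame;
  valuation : P -> concept mframe
}.

Section Semantics.
Variables (P : Type) (X Y : eqType) (M : model P).

Fixpoint value (e : X + Y -> concept M) (phi : form P X Y) : concept M :=
  match phi with
  | Atom p => valuation M p
  | NuVar x => e (inl x)
  | MuVar y => e (inr y)
  | Bot => \bot%O
  | Top => \top%O
  | Or a b => (value e a `|` value e b)%O
  | And a b => (value e a `&` value e b)%O
  | Box a => cbox (value e a)
  | Dia a => cdia (value e a)
  | Mu y a => lfp (fun c => value [eta e with inr y |-> c] a)
  | Nu x a => gfp (fun c => value [eta e with inl x |-> c] a)
  end.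

Lemma value_free (phi : form P X Y) (e e' : X + Y -> concept M) :
  (forall v, occurs_free v phi -> e v = e' v) -> value e phi = value e' phi.
Proof.
elim: phi e e' => //=.
- by move=> x e e'; apply.
- by move=> y e e'; apply.
- by move=> a iha b ihb e e' h; congr (_ `|` _)%O;
    [apply: iha|apply: ihb] => v fv; apply: h; rewrite fv ?orbT.
- by move=> a iha b ihb e e' h; congr (_ `&` _)%O;
    [apply: iha|apply: ihb] => v fv; apply: h; rewrite fv ?orbT.
- by move=> a iha e e' h; rewrite (iha e e').
- by move=> a iha e e' h; rewrite (iha e e').
- move=> y a iha e e' h; congr lfp; apply/funext => c; apply: iha => v fv /=.
  by case: eqP => // /eqP vy; apply: h; rewrite vy.
- move=> x a iha e e' h; congr gfp; apply/funext => c; apply: iha => v fv /=.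
  by case: eqP => // /eqP vx; apply: h; rewrite vx.
Qed.

Lemma value_closed (phi : form P X Y) (e e' : X + Y -> concept M) :
  closed_form phi -> value e phi = value e' phi.
Proof. by move=> cl; apply: value_free => v; rewrite (negbTE (cl v)). Qed.

Lemma value_mono (phi : form P X Y) (e e' : X + Y -> concept M) :
  (forall v, e v <= e' v)%O -> (value e phi <= value e' phi)%O.
Proof.
have upd (e1 e2 : X + Y -> concept M) w c d :
    (forall v, e1 v <= e2 v)%O -> (c <= d)%O ->
    forall v, ([eta e1 with w |-> c] v <= [eta e2 with w |-> d] v)%O.
  by move=> h cd v /=; case: eqP.
elim: phi e e' => //=.
- by move=> a iha b ihb e e' h; apply: leU2; [apply: iha|apply: ihb].
- by move=> a iha b ihb e e' h; apply: leI2; [apply: iha|apply: ihb].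
- move=> a iha e e' h; apply/asboolP => g hg m hm; apply: hg.
  by have /cle_intent := iha _ _ h; apply.
- move=> a iha e e' h; apply/cle_intent => m hm g hg; apply: hm.
  by have /asboolP := iha _ _ h; apply.
- move=> y a iha e e' h.
  rewrite !lfpE; do ?by move=> c d cd; apply: iha => v; apply: upd.
  apply/cinf_glb => d /= hd.
  have [+ _] := cinf_glb [set c | (value [eta e with inr y |-> c] a <= c)%O]
    (cinf [set c | (value [eta e with inr y |-> c] a <= c)%O]).
  apply=> //=; apply: le_trans hd; exact/iha/upd.
- move=> x a iha e e' h.
  rewrite !gfpE; do ?by move=> c d cd; apply: iha => v; apply: upd.
  apply/csup_lub => d /= hd.
  have [+ _] := csup_lub [set c | (c <= value [eta e' with inl x |-> c] a)%O]
    (csup [set c | (c <= value [eta e' with inl x |-> c] a)%O]).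
  apply=> //=; apply: (le_trans hd); exact/iha/upd.
Qed.

(* For a closed formula the choice of assignment is immaterial (value_closed). *)
Definition closed_value (phi : form P X Y) : concept M :=
  value (fun=> \bot%O) phi.

Definition forces (g : obj M) (phi : form P X Y) : Prop :=
  extent (closed_value phi) g.
Definition refutes (m : feat M) (phi : form P X Y) : Prop :=
  intent (closed_value phi) m.

End Semantics.

Arguments forces {P X Y} M g phi.
Arguments refutes {P X Y} M m phi.

Record simulation (P : Type) (M1 M2 : model P)
    (S : obj M1 -> obj M2 -> Prop) (T : feat M1 -> feat M2 -> Prop) : Prop := {
  sim_val_obj : forall (p : P) g1 g2,
    S g1 g2 -> extent (valuation M1 p) g1 -> extent (valuation M2 p) g2;
  sim_val_feat : forall (p : P) m1 m2,
    T m1 m2 -> intent (valuation M2 p) m2 -> intent (valuation M1 p) m1;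
  sim_inc_obj : forall g1 g2 m2,
    S g1 g2 -> ~ inc g2 m2 -> exists m1, ~ inc g1 m1 /\ T m1 m2;
  sim_inc_feat : forall m1 m2 g1,
    T m1 m2 -> ~ inc g1 m1 -> exists g2, ~ inc g2 m2 /\ S g1 g2;
  sim_box : forall g1 g2 m2,
    S g1 g2 -> ~ rbox g2 m2 -> exists m1, ~ rbox g1 m1 /\ T m1 m2;
  sim_dia : forall m1 m2 g1,
    T m1 m2 -> ~ rdia m1 g1 -> exists g2, ~ rdia m2 g2 /\ S g1 g2
}.

(* Main.v *)
(**
  Call c1 and c2 similar when S carries the extension of c1 into that of c2;
  by the incidence clauses of a simulation this is the same as T carrying the
  intension of c2 back into that of c1.  The first description shows that
  similarity is preserved by meets on the right, the second that it is
  preserved by joins on the left.  So every c2 has a greatest concept similar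
  to it, which is a pre-fixed point of the first map when c2 is the least fixed
  point of the second; dually for greatest fixed points.
*)
Require Import Defs.
From mathcomp Require Import all_boot all_order.
From mathcomp Require Import boolp classical_sets.

Import Order.Theory.
Local Open Scope classical_set_scope.

Section Simulation.
Set Implicit Arguments.
Unset Strict Implicit.
Variables (P : Type) (X Y : eqType) (M1 M2 : model P).
Variables (S : obj M1 -> obj M2 -> Prop) (T : feat M1 -> feat M2 -> Prop).
Hypothesis simST : simulation S T.

Definition similar (c1 : concept M1) (c2 : concept M2) : Prop :=
  forall g1 g2, S g1 g2 -> extent c1 g1 -> extent c2 g2.

(** By contraposition: an object of [extent c1] not incident to [m1] has, by [sim_inc_feat], an
    [S]-image not incident to [m2]; [sim_inc_obj] serves the converse. *)
Lemma similar_intent c1 c2 :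
  similar c1 c2 <->
  forall m1 m2, T m1 m2 -> intent c2 m2 -> intent c1 m1.
Proof.
split=> [sim m1 m2 Tm|sim g1 g2 Sg].
- rewrite (intentE c2) (intentE c1) => m2c g1 g1c.
  apply: contrapT => /(sim_inc_feat simST Tm)[g2 [nI Sg]].
  by apply/nI/m2c/(sim _ _ Sg).
- rewrite (extentE c1) (extentE c2) => g1c m2 m2c.
  apply: contrapT => /(sim_inc_obj simST Sg)[m1 [nI Tm]].
  by apply/nI/g1c/(sim _ _ Tm).
Qed.

Lemma similar_le c1 c1' c2 c2' :
  (c1 <= c1')%O -> (c2' <= c2)%O -> similar c1' c2' -> similar c1 c2.
Proof.
by move=> /asboolP le1 /asboolP le2 sim g1 g2 Sg /le1 /(sim _ _ Sg) /le2.
Qed.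

Lemma similar_csup (D : set (concept M1)) c2 :
  (forall c1, D c1 -> similar c1 c2) -> similar (csup D) c2.
Proof.
move=> sim; apply/similar_intent => m1 m2 Tm m2c /= c1 Dc1.
by have /similar_intent sim1 := sim _ Dc1; exact: sim1 Tm m2c.
Qed.

Lemma similar_cinf c1 (D : set (concept M2)) :
  (forall c2, D c2 -> similar c1 c2) -> similar c1 (cinf D).
Proof. by move=> sim g1 g2 Sg g1c /= c2 Dc2; exact: sim Dc2 _ _ Sg g1c. Qed.

(** Box is computed from intensions, so similarity enters in its intensional form, and [sim_box]
    replaces the incidence clause. *)
Lemma similar_cbox c1 c2 : similar c1 c2 -> similar (cbox c1) (cbox c2).
Proof.
move=> /similar_intent sim g1 g2 Sg /= g1c m2 m2c.
apply: contrapT => /(sim_box simST Sg)[m1 [nR Tm]].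
by apply/nR/g1c/(sim _ _ Tm).
Qed.

Lemma similar_cdia c1 c2 : similar c1 c2 -> similar (cdia c1) (cdia c2).
Proof.
move=> sim; apply/similar_intent => m1 m2 Tm /= m2c g1 g1c.
apply: contrapT => /(sim_dia simST Tm)[g2 [nR Sg]].
by apply/nR/m2c/(sim _ _ Sg).
Qed.

Section Fixpoints.
Variables (f1 : concept M1 -> concept M1) (f2 : concept M2 -> concept M2).
Hypothesis f1_homo : {homo f1 : c d / (c <= d)%O}.
Hypothesis f2_homo : {homo f2 : c d / (c <= d)%O}.
Hypothesis similar_f : forall c1 c2, similar c1 c2 -> similar (f1 c1) (f2 c2).

Lemma similar_lfp : similar (lfp f1) (lfp f2).
Proof.
have [fix2 _] := lfp_cinf f2_homo; rewrite !lfpE //.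
set l2 := cinf [set c | (f2 c <= c)%O] in fix2 *.
pose a := csup [set c1 | similar c1 l2].
have sim_a : similar a l2 by exact: similar_csup.
apply: (similar_le _ _ sim_a) => //.
set D := [set c | (f1 c <= c)%O].
have [+ _] := cinf_glb D (cinf D); apply=> //=.
(* [f1 a] is similar to [f2 l2], which is [l2], so it is one of the concepts joined in [a]. *)
have [+ _] := csup_lub [set c1 | similar c1 l2] a; apply=> //=.
by rewrite -fix2; exact: similar_f.
Qed.

Lemma similar_gfp : similar (gfp f1) (gfp f2).
Proof.
have [fix1 _] := gfp_csup f1_homo; rewrite !gfpE //.
set l1 := csup [set c | (c <= f1 c)%O] in fix1 *.
pose a := cinf [set c2 | similar l1 c2].
have sim_a : similar l1 a by exact: similar_cinf.
apply: (similar_le _ _ sim_a) => //.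
set D := [set c | (c <= f2 c)%O].
have [+ _] := csup_lub D (csup D); apply=> //=.
(* [l1 = f1 l1] is similar to [f2 a], so [f2 a] is one of the concepts met in [a], which is thus a
   post-fixed point of [f2]. *)
have [+ _] := cinf_glb [set c2 | similar l1 c2] a; apply=> //=.
by rewrite -fix1; exact: similar_f.
Qed.

End Fixpoints.

Lemma value_upd_homo (M : model P) (phi : form P X Y)
    (e : X + Y -> concept M) (v : X + Y) :
  {homo (fun c => value [eta e with v |-> c] phi) : c d / (c <= d)%O}.
Proof. by move=> c d cd; apply: value_mono => w /=; case: eqP. Qed.

(** Arbitrary pairs of similar assignments are needed because the body of a fixed point is open.
    Bottom and joins are treated on intensions, where they are the whole set and intersections. *)
Lemma similar_value (phi : form P X Y)
    (e1 : X + Y -> concept M1) (e2 : X + Y -> concept M2) :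
  (forall v, similar (e1 v) (e2 v)) -> similar (value e1 phi) (value e2 phi).
Proof.
elim: phi e1 e2 => //=.
- by move=> p e1 e2 _ g1 g2; exact: (sim_val_obj simST).
- by move=> e1 e2 _; apply/similar_intent => m1 m2.
- move=> a iha b ihb e1 e2 sim; apply/similar_intent => m1 m2 Tm [am bm].
  have /similar_intent sima := iha _ _ sim.
  have /similar_intent simb := ihb _ _ sim.
  by split; [apply: sima Tm am|apply: simb Tm bm].
- move=> a iha b ihb e1 e2 sim g1 g2 Sg [ag bg].
  by split; [apply: (iha _ _ sim) Sg ag|apply: (ihb _ _ sim) Sg bg].
- by move=> a iha e1 e2 sim; apply/similar_cbox/iha.
- by move=> a iha e1 e2 sim; apply/similar_cdia/iha.
- move=> y a iha e1 e2 sim; apply: similar_lfp; try exact: value_upd_homo.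
  by move=> c1 c2 sim_c; apply: iha => v /=; case: eqP.
- move=> x a iha e1 e2 sim; apply: similar_gfp; try exact: value_upd_homo.
  by move=> c1 c2 sim_c; apply: iha => v /=; case: eqP.
Qed.

End Simulation.

Theorem theorem7 (P : Type) (X Y : eqType) (M1 M2 : model P)
    (S : obj M1 -> obj M2 -> Prop) (T : feat M1 -> feat M2 -> Prop)
    (simST : simulation S T) (phi : form P X Y) (closed_phi : closed_form phi) :
  (forall (g1 : obj M1) (g2 : obj M2),
     S g1 g2 -> forces M1 g1 phi -> forces M2 g2 phi) /\
  (forall (m1 : feat M1) (m2 : feat M2),
     T m1 m2 -> refutes M2 m2 phi -> refutes M1 m1 phi).
Proof.
have sim : similar S (closed_value M1 phi) (closed_value M2 phi).
  apply: (similar_value simST) => _.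
  (* The extension of bottom may be nonempty, but its intension is everything. *)
  by apply/(similar_intent simST) => m1 m2.
split; first exact: sim.
by move: sim => /(similar_intent simST).
Qed.
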